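(* Let $(H,I)$ be both a Dorroh pair of algebras and a Dorroh pair of coalgebras. Then $H\ltimes_d I$ (with its algebra structure and its coalgebra structure recalled in the context) is a bialgebra if and only if the following conditions (a)-(d) are satisfied. (a) $H$ is a bialgebra, i.e., for all $a,b\in H$, $\sum (ab)_1\otimes (ab)_2=\sum a_1b_1\otimes a_2b_2$. (b) The comultiplication of $I$ and the left and right $H$-comodule structure maps of $I$ are all $H$-bimodule homomorphisms, i.e., for all $a,b\in H$ and $x,y\in I$, $$\sum (ay)_1\otimes (ay)_2=\sum a_1y_1\otimes a_2y_2,\qquad \sum (xb)_1\otimes (xb)_2=\sum x_1b_1\otimes x_2b_2,$$ $$\sum (ay)_{(-1)}\otimes (ay)_{(0)}=\sum a_1y_{(-1)}\otimes a_2y_{(0)},\qquad \sum (xb)_{(-1)}\otimes (xb)_{(0)}=\sum x_{(-1)}b_1\otimes x_{(0)}b_2,$$ $$\sum (ay)_{(0)}\otimes (ay)_{(1)}=\sum a_1y_{(0)}\otimes a_2y_{(1)},\qquad \sum (xb)_{(0)}\otimes (xb)_{(1)}=\sum x_{(0)}b_1\otimes x_{(1)}b_2.$$ (c) The left and right $H$-comodule structure maps of $I$ are both algebra homomorphisms, i.e., for all $x,y\in I$, $$\sum (xy)_{(-1)}\otimes (xy)_{(0)}=\sum x_{(-1)}y_{(-1)}\otimes x_{(0)}y_{(0)},\qquad \sum (xy)_{(0)}\otimes (xy)_{(1)}=\sum x_{(0)}y_{(0)}\otimes x_{(1)}y_{(1)}.$$ (d) For all $x,y\in I$, $$\begin{aligned}\sum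 (xy)_1\otimes (xy)_2=&\sum x_{(-1)}y_{(0)}\otimes x_{(0)}y_{(1)}+\sum x_{(-1)}y_1\otimes x_{(0)}y_2+\sum x_{(0)}y_{(-1)}\otimes x_{(1)}y_{(0)}\\&+\sum x_{(0)}y_1\otimes x_{(1)}y_2+\sum x_1y_{(-1)}\otimes x_2y_{(0)}+\sum x_1y_{(0)}\otimes x_2y_{(1)}+\sum x_1y_1\otimes x_2y_2.\end{aligned}$$ In this case, if $H$ and $I$ are regarded as subspaces of $H\ltimes_d I$ via $h\mapsto (h,0)$ and $x\mapsto (0,x)$ respectively, then $H\ltimes_d I$ is a bialgebra Dorroh extension of $H$ by $I$.
   Context: Everything is over a field $k$, $\otimes=\otimes_k$. Algebras are associative but not necessarily unital; coalgebras are coassociative but not necessarily counital. If an algebra is unital, its modules are assumed unital; if a coalgebra is counital, its comodules are assumed counital. Write $\Delta(c)=\sum c_1\otimes c_2$, $\rho_l(x)=\sum x_{(-1)}\otimes x_{(0)}\in H\otimes I$ and $\rho_r(x)=\sum x_{(0)}\otimes x_{(1)}\in I\otimes H$ for left and right $H$-comodule structure maps. A bialgebra is a vector space $B$ that is both an algebra and a coalgebra with $\Delta(ab)=\Delta(a)\Delta(b)$ for all $a,b\in B$ (no identity or counit required). $(H,I)$ is a Dorroh pair of algebras if $H$ and $I$ are algebras, $I$ is an $H$-bimodule, and $a(xy)=(ax)y$, $(xa)y=x(ay)$, $(xy)a=x(ya)$ for all $a\in H$, $x,y\in I$. Then $H\ltimes_d I=H\oplus I$ is an algebra with multiplication $(a,x)(b,y)=(ab,\,ay+xb+xy)$.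 $(H,I)$ is a Dorroh pair of coalgebras if $H$ and $I$ are coalgebras, $I$ is an $H$-bicomodule, and for all $x\in I$: $\sum x_1\otimes x_{2(0)}\otimes x_{2(1)}=\sum x_{(0)1}\otimes x_{(0)2}\otimes x_{(1)}$, $\sum x_{1(-1)}\otimes x_{1(0)}\otimes x_2=\sum x_{(-1)}\otimes x_{(0)1}\otimes x_{(0)2}$, $\sum x_{1(0)}\otimes x_{1(1)}\otimes x_2=\sum x_1\otimes x_{2(-1)}\otimes x_{2(0)}$. Then $H\ltimes_d I=H\oplus I$ is a coalgebra with $\Delta(h,x)=\sum (h_1,0)\otimes (h_2,0)+\sum (x_{(-1)},0)\otimes (0,x_{(0)})+\sum (0,x_{(0)})\otimes (x_{(1)},0)+\sum (0,x_1)\otimes (0,x_2)$. A coideal of a coalgebra $B$ is a subspace $V$ with $\Delta(V)\subseteq V\otimes B+B\otimes V$; a biideal of a bialgebra is a subspace that is both a two-sided ideal and a coideal. For a bialgebra $H$, a bialgebra $B$ is called a bialgebra Dorroh extension of $H$ by $I$ if $H$ is a subbialgebra of $B$, $I$ is a biideal of $B$, and $B=H\oplus I$ as vector spaces. *)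

(* Defs.v *)
From HB Require Import structures.
From mathcomp Require Import all_boot all_order all_algebra.
From mathcomp Require Import generic_quotient.
From mathcomp Require Import boolp classical_sets.

Set Implicit Arguments.
Unset Strict Implicit.
Unset Printing Implicit Defensive.

Import GRing.Theory.
Local Open Scope ring_scope.
Local Open Scope quotient_scope.

(* The tensor product of two k-vector spaces. A list [:: (v1, w1); ...]        *)
(* stands for the formal sum of the pairs (v_i, w_i), and the relations are    *)
(* the defining relations of V ⊗ W. [ten_zero] is a separate relation because  *)
(* formal sums have no subtraction.                                            *)
Inductive ten_eq (k : fieldType) (V W : lmodType k) :
    seq (V * W) -> seq (V * W) -> Prop :=
| ten_refl s : ten_eq s s
| ten_sym s t : ten_eq s t -> ten_eq t s
| ten_trans s t u : ten_eq s t -> ten_eq t u -> ten_eq s u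
| ten_cat s s' t t' : ten_eq s s' -> ten_eq t t' -> ten_eq (s ++ t) (s' ++ t')
| ten_comm s t : ten_eq (s ++ t) (t ++ s)
| ten_addl v v' w : ten_eq [:: (v + v', w)] [:: (v, w); (v', w)]
| ten_addr v w w' : ten_eq [:: (v, w + w')] [:: (v, w); (v, w')]
| ten_scale c v w : ten_eq [:: (c *: v, w)] [:: (v, c *: w)]
| ten_zero w : ten_eq [:: (0, w)] [::].

Arguments ten_zero {k V W} w.

Section TensorProduct.
Variables (k : fieldType) (V W : lmodType k).
Implicit Types s t : seq (V * W).

Definition ten_rel : rel (seq (V * W)) := fun s t => `[< ten_eq s t >].

Fact ten_rel_refl : reflexive ten_rel.
Proof. by move=> s; apply/asboolP; exact: ten_refl. Qed.

Fact ten_rel_sym : symmetric ten_rel.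
Proof.
by move=> s t; apply/asboolP/asboolP; exact: ten_sym.
Qed.

Fact ten_rel_trans : transitive ten_rel.
Proof.
by move=> t s u /asboolP st /asboolP tu; apply/asboolP; exact: ten_trans st tu.
Qed.

Canonical ten_equiv := EquivRel ten_rel ten_rel_refl ten_rel_sym ten_rel_trans.

Definition tensor := {eq_quot ten_equiv}.
HB.instance Definition _ := Choice.on tensor.
HB.instance Definition _ := EqQuotient.on tensor.

Definition tens (v : V) (w : W) : tensor := \pi_tensor [:: (v, w)].

Lemma ten_pi s t : ten_eq s t <-> \pi_tensor s = \pi_tensor t.
Proof.
split=> [st|]; first by apply/eqmodP/asboolP.
by move/eqmodP/asboolP.
Qed.

Lemma ten_repr s : ten_eq (repr (\pi_tensor s)) s.
Proof. by apply/ten_pi; rewrite reprK. Qed.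

Definition ten_scale_seq (c : k) s := [seq (c *: p.1, p.2) | p <- s].

Lemma ten_scale_seq_eq c s t :
  ten_eq s t -> ten_eq (ten_scale_seq c s) (ten_scale_seq c t).
Proof.
elim=> {s t} [s|s t _ +|s t u _ + _ +|s s' t t' _ + _ +|s t|v v' w|v w w'|a v w|w];
  rewrite /ten_scale_seq ?map_cat /=.
- exact: ten_refl.
- exact: ten_sym.
- exact: ten_trans.
- exact: ten_cat.
- exact: ten_comm.
- by rewrite scalerDr; exact: ten_addl.
- exact: ten_addr.
- by rewrite scalerA mulrC -scalerA; exact: ten_scale.
- by rewrite scaler0; exact: ten_zero.
Qed.

Definition ten0 : tensor := \pi_tensor [::].
Definition ten_add : tensor -> tensor -> tensor := lift_op2 tensor cat.
Definition ten_scaler (c : k) : tensor -> tensor :=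
  lift_op1 tensor (ten_scale_seq c).
Definition ten_opp (x : tensor) : tensor := ten_scaler (-1) x.

Lemma ten_addE s t : ten_add (\pi_tensor s) (\pi_tensor t) = \pi_tensor (s ++ t).
Proof. by unlock ten_add; apply/ten_pi; apply: ten_cat; exact: ten_repr. Qed.

Lemma ten_scalerE c s :
  ten_scaler c (\pi_tensor s) = \pi_tensor (ten_scale_seq c s).
Proof.
by unlock ten_scaler; apply/ten_pi; apply: ten_scale_seq_eq; exact: ten_repr.
Qed.

Fact ten_addA : associative ten_add.
Proof.
move=> x y z; rewrite -[x]reprK -[y]reprK -[z]reprK.
by rewrite !ten_addE catA.
Qed.

Fact ten_addC : commutative ten_add.
Proof. by move=> x y; unlock ten_add; apply/ten_pi; exact: ten_comm. Qed.

Fact ten_add0 : left_id ten0 ten_add.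
Proof. by move=> x; rewrite -[x]reprK ten_addE. Qed.

Fact ten_scalerDl x : {morph ten_scaler^~ x : a b / a + b >-> ten_add a b}.
Proof.
move=> a b; rewrite -[x]reprK !ten_scalerE ten_addE; apply/ten_pi.
elim: (repr x) => [|p s IHs] /=; first exact: ten_refl.
rewrite -cat1s scalerDl.
apply: ten_trans (ten_cat (ten_addl _ _ _) IHs) _ => /=.
set A := ten_scale_seq a s; set B := ten_scale_seq b s; set q := (b *: _, _).
apply: (ten_cat (ten_refl [:: _]) (t := q :: A ++ B)).
have -> : A ++ q :: B = (A ++ [:: q]) ++ B by rewrite -catA.
exact: (ten_cat (ten_comm [:: q] A) (ten_refl B)).
Qed.

Fact ten_scaler1 : left_id 1 ten_scaler.
Proof.
move=> x; rewrite -[x]reprK ten_scalerE /ten_scale_seq.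
by under eq_map do rewrite scale1r -surjective_pairing; rewrite map_id.
Qed.

Fact ten_scaler0 x : ten_scaler 0 x = ten0.
Proof.
rewrite -[x]reprK ten_scalerE; apply/ten_pi.
elim: (repr x) => [|p s IHs] /=; first exact: ten_refl.
by rewrite scale0r; exact: (ten_cat (ten_zero p.2) IHs).
Qed.

Fact ten_addN : left_inverse ten0 ten_opp ten_add.
Proof.
move=> x; rewrite -{2}[x]ten_scaler1 -ten_scalerDl addNr.
exact: ten_scaler0.
Qed.

HB.instance Definition _ :=
  GRing.isZmodule.Build tensor ten_addA ten_addC ten_add0 ten_addN.

Fact ten_scalerA a b x : ten_scaler a (ten_scaler b x) = ten_scaler (a * b) x.
Proof.
rewrite -[x]reprK !ten_scalerE /ten_scale_seq -map_comp.
by congr (\pi_tensor _); apply: eq_map => p /=; rewrite scalerA.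
Qed.

Fact ten_scalerDr : right_distributive ten_scaler +%R.
Proof.
move=> a x y; rewrite -[x]reprK -[y]reprK !ten_scalerE.
by rewrite /GRing.add /= !ten_addE ten_scalerE /ten_scale_seq map_cat.
Qed.

HB.instance Definition _ := GRing.Zmodule_isLmodule.Build k tensor
  ten_scalerA ten_scaler1 ten_scalerDr ten_scalerDl.

Lemma ten_piD s t : \pi_tensor (s ++ t) = \pi_tensor s + \pi_tensor t :> tensor.
Proof. exact: esym (ten_addE s t). Qed.

Lemma ten_piZ c s :
  \pi_tensor (ten_scale_seq c s) = c *: (\pi_tensor s : tensor).
Proof. exact: esym (ten_scalerE c s). Qed.

End TensorProduct.

Notation "v ⊗ w" := (tens v w) (at level 40, left associativity) : ring_scope.

Notation is_bilinear f := (bilinear_for *:%R *:%R f).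

Section UniversalProperty.
Variables (k : fieldType) (V W : lmodType k).

Lemma tens_is_bilinear : is_bilinear (@tens k V W).
Proof.
split=> [w c v v'|v c w w'].
- rewrite /tens /= -ten_piZ -ten_piD; apply/ten_pi; exact: ten_addl.
- rewrite /tens /= -ten_piZ -ten_piD; apply/ten_pi; apply: ten_trans (ten_addr _ _ _) _.
  rewrite -cat1s -[X in ten_eq _ X]cat1s; apply: ten_cat; last exact: ten_refl.
  by apply: ten_sym; exact: ten_scale.
Qed.

HB.instance Definition _ :=
  bilinear_isBilinear.Build k V W (tensor V W) *:%R *:%R (@tens k V W)
    tens_is_bilinear.

Lemma tens_sum (s : seq (V * W)) :
  \pi_(tensor V W) s = \sum_(p <- s) p.1 ⊗ p.2.
Proof.
elim: s => [|[v w] s IHs]; first by rewrite big_nil.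
by rewrite big_cons -IHs -ten_piD.
Qed.

(* The linear map V ⊗ W -> U induced by a bilinear map f, by evaluation on a    *)
(* representative. It is well behaved only for bilinear f (see [tlift_tens],   *)
(* [tlift_linear] and [tlift_unique]).                                         *)
Definition tlift (U : lmodType k) (f : V -> W -> U) (x : tensor V W) : U :=
  \sum_(p <- repr x) f p.1 p.2.

Section Lift.
Variables (U : lmodType k) (f : V -> W -> U).
Hypothesis fbil : is_bilinear f.

Lemma tlift_pi (s : seq (V * W)) :
  tlift f (\pi_(tensor V W) s) = \sum_(p <- s) f p.1 p.2.
Proof.
have fl w : f 0 w = 0.
  by have /= := fbil.1 w (-1) 0 0; rewrite scaler0 addr0 scaleN1r addNr.
have flD v v' w : f (v + v') w = f v w + f v' w.
  by have /= := fbil.1 w 1 v v'; rewrite !scale1r.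
have frD v w w' : f v (w + w') = f v w + f v w'.
  by have /= := fbil.2 v 1 w w'; rewrite !scale1r.
have fr v : f v 0 = 0.
  by have /= := fbil.2 v (-1) 0 0; rewrite scaler0 addr0 scaleN1r addNr.
have fZ c v w : f (c *: v) w = f v (c *: w).
  have /= := fbil.1 w c v 0; rewrite !addr0 fl addr0 => ->.
  by have /= := fbil.2 v c w 0; rewrite !addr0 fr addr0 => ->.
suff E t u : ten_eq t u -> \sum_(p <- t) f p.1 p.2 = \sum_(p <- u) f p.1 p.2.
  exact/E/ten_repr.
elim=> {t u} [//|t u _ ->//|t u w _ -> _ ->//|||||c v w|w].
- by move=> t t' u u' _ IHt _ IHu; rewrite !big_cat /= IHt IHu.
- by move=> t u; rewrite !big_cat /= addrC.
- by move=> v v' w; rewrite !big_cons !big_nil /= !addr0 flD.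
- by move=> v w w'; rewrite !big_cons !big_nil /= !addr0 frD.
- by rewrite !big_cons !big_nil /= !addr0 fZ.
- by rewrite !big_cons !big_nil /= !addr0 fl.
Qed.

Lemma tlift_tens v w : tlift f (v ⊗ w) = f v w.
Proof. by rewrite tlift_pi big_seq1. Qed.

Lemma tlift_linear : linear (tlift f).
Proof.
have fZ c v w : f (c *: v) w = c *: f v w.
  have /= := fbil.1 w c v 0; rewrite !addr0 => ->.
  have -> : f 0 w = 0.
    by have /= := fbil.1 w (-1) 0 0; rewrite scaler0 addr0 scaleN1r addNr.
  by rewrite addr0.
move=> c x y; rewrite -[x]reprK -[y]reprK.
rewrite -ten_piZ -ten_piD !tlift_pi.
rewrite big_cat /= big_map scaler_sumr; congr (_ + _).
by apply: eq_bigr => p _; exact: fZ.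
Qed.

Lemma tlift_unique (g : {linear tensor V W -> U}) :
  (forall v w, g (v ⊗ w) = f v w) -> g =1 tlift f.
Proof.
move=> gf x; rewrite -[x]reprK tlift_pi tens_sum linear_sum.
by apply: eq_bigr => p _; exact: gf.
Qed.

End Lift.

End UniversalProperty.

Section TensorMaps.
Variable k : fieldType.

Section Map.
Variables (V W V' W' : lmodType k) (f : {linear V -> V'}) (g : {linear W -> W'}).

Definition tmap : tensor V W -> tensor V' W' := tlift (fun v w => f v ⊗ g w).

Lemma tmap_is_bilinear : is_bilinear (fun v w => f v ⊗ g w).
Proof.
by split=> [w|v] c u u'; rewrite linearP (linearPl, linearPr).
Qed.

HB.instance Definition _ := GRing.isLinear.Build k (tensor V W) (tensor V' W')
  *:%R tmap (tlift_linear tmap_is_bilinear).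

Lemma tmap_tens v w : tmap (v ⊗ w) = f v ⊗ g w.
Proof. exact: (tlift_tens tmap_is_bilinear). Qed.

End Map.

(* In Sweedler notation, [tens2 f g s t] is \sum f s_1 t_1 ⊗ g s_2 t_2.        *)
Section Bimap.
Variables (U V W U' V' W' : lmodType k).
Variables (f : {bilinear U -> V -> W}) (g : {bilinear U' -> V' -> W'}).

Definition tens2 (s : tensor U U') (t : tensor V V') : tensor W W' :=
  tlift (fun u u' => tlift (fun v v' => f u v ⊗ g u' v') t) s.

Lemma tens2_inner_bilinear u u' : is_bilinear (fun v v' => f u v ⊗ g u' v').
Proof. by split=> [w|v] c x y; rewrite linearPr (linearPl, linearPr). Qed.

Lemma tens2_outer_bilinear t :
  is_bilinear (fun u u' => tlift (fun v v' => f u v ⊗ g u' v') t).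
Proof.
split=> [w|v] c x y; rewrite /tlift /= scaler_sumr -big_split /=;
  by apply: eq_bigr => p _; rewrite linearPl (linearPl, linearPr).
Qed.

Lemma tens2_is_bilinear : is_bilinear tens2.
Proof.
split=> [t|s] c x y; first exact: (tlift_linear (tens2_outer_bilinear t)).
have E z : tens2 s z
  = \sum_(p <- repr s) tlift (fun v v' => f p.1 v ⊗ g p.2 v') z by [].
rewrite !E /= scaler_sumr -big_split /=.
by apply: eq_bigr => p _; rewrite (tlift_linear (tens2_inner_bilinear _ _)).
Qed.

HB.instance Definition _ := bilinear_isBilinear.Build k (tensor U U')
  (tensor V V') (tensor W W') *:%R *:%R tens2 tens2_is_bilinear.

Lemma tens2_tens u u' v v' : tens2 (u ⊗ u') (v ⊗ v') = f u v ⊗ g u' v'.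
Proof.
by rewrite /tens2 (tlift_tens (tens2_outer_bilinear _))
           (tlift_tens (tens2_inner_bilinear _ _)).
Qed.

End Bimap.

Section Assoc.
Variables U V W : lmodType k.

Definition tassoc : tensor (tensor U V) W -> tensor U (tensor V W) :=
  tlift (fun s w => tlift (fun u v => u ⊗ (v ⊗ w)) s).

Lemma tassoc_inner_bilinear (w : W) :
  is_bilinear (fun (u : U) (v : V) => u ⊗ (v ⊗ w)).
Proof. by split=> [v|u] c x y; rewrite /= ?linearPl ?linearPr. Qed.

Lemma tassoc_outer_bilinear :
  is_bilinear (fun (s : tensor U V) (w : W) =>
    tlift (fun (u : U) (v : V) => u ⊗ (v ⊗ w)) s).
Proof.
split=> [w|s] c x y; first exact: (tlift_linear (tassoc_inner_bilinear w)).
rewrite /tlift /= scaler_sumr -big_split /=.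
by apply: eq_bigr => p _; rewrite !linearPr.
Qed.

HB.instance Definition _ := GRing.isLinear.Build k (tensor (tensor U V) W)
  (tensor U (tensor V W)) *:%R tassoc (tlift_linear tassoc_outer_bilinear).

Lemma tassoc_tens u v w : tassoc (u ⊗ v ⊗ w) = u ⊗ (v ⊗ w).
Proof.
by rewrite /tassoc (tlift_tens tassoc_outer_bilinear)
           (tlift_tens (tassoc_inner_bilinear _)).
Qed.

End Assoc.
End TensorMaps.

Section Structures.
Variable k : fieldType.

Definition is_algebra (A : lmodType k) (m : {bilinear A -> A -> A}) : Prop :=
  associative m.

Definition is_coalgebra (C : lmodType k) (d : {linear C -> tensor C C}) : Prop :=
  forall c, tassoc (tmap d idfun (d c)) = tmap idfun d (d c).

Definition is_bialgebra (B : lmodType k) (m : {bilinear B -> B -> B})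
    (d : {linear B -> tensor B B}) : Prop :=
  [/\ is_algebra m, is_coalgebra d
    & forall a b, d (m a b) = tens2 m m (d a) (d b)].

(* The zero algebra is not counted as unital, nor the zero coalgebra as        *)
(* counital.                                                                   *)
Definition is_identity (A : lmodType k) (m : {bilinear A -> A -> A}) (e : A) :
    Prop :=
  e != 0 /\ forall a, m e a = a /\ m a e = a.

Definition is_counit (C : lmodType k) (d : {linear C -> tensor C C})
    (e : {scalar C}) : Prop :=
  (exists c, e c != 0) /\
  forall c, tlift (fun c1 c2 => e c1 *: c2) (d c) = c /\
            tlift (fun c1 c2 => e c2 *: c1) (d c) = c.

Definition is_bimodule (A M : lmodType k) (m : {bilinear A -> A -> A})
    (la : {bilinear A -> M -> M}) (ra : {bilinear M -> A -> M}) : Prop :=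
  [/\ forall a b x, la (m a b) x = la a (la b x),
      forall x a b, ra x (m a b) = ra (ra x a) b,
      forall a x b, ra (la a x) b = la a (ra x b)
    & forall e, is_identity m e -> forall x, la e x = x /\ ra x e = x].

Definition is_bicomodule (C M : lmodType k) (d : {linear C -> tensor C C})
    (rl : {linear M -> tensor C M}) (rr : {linear M -> tensor M C}) : Prop :=
  [/\ forall x, tassoc (tmap d idfun (rl x)) = tmap idfun rl (rl x),
      forall x, tassoc (tmap rr idfun (rr x)) = tmap idfun d (rr x),
      forall x, tassoc (tmap rl idfun (rr x)) = tmap idfun rr (rl x)
    & forall e, is_counit d e ->
        forall x, tlift (fun c y => e c *: y) (rl x) = x /\
                  tlift (fun y c => e c *: y) (rr x) = x].

Section Dorroh.
Variables H I : lmodType k.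
Variables (mH : {bilinear H -> H -> H}) (mI : {bilinear I -> I -> I}).
Variables (la : {bilinear H -> I -> I}) (ra : {bilinear I -> H -> I}).
Variables (dH : {linear H -> tensor H H}) (dI : {linear I -> tensor I I}).
Variables (rl : {linear I -> tensor H I}) (rr : {linear I -> tensor I H}).

Definition dorroh_pair_algebras : Prop :=
  [/\ is_algebra mH, is_algebra mI, is_bimodule mH la ra
    & forall a x y, [/\ la a (mI x y) = mI (la a x) y,
                        mI (ra x a) y = mI x (la a y)
                      & ra (mI x y) a = mI x (ra y a)]].

Definition dorroh_pair_coalgebras : Prop :=
  [/\ is_coalgebra dH, is_coalgebra dI, is_bicomodule dH rl rr
    & forall x,
        [/\ tmap idfun rr (dI x) = tassoc (tmap dI idfun (rr x)),
            tassoc (tmap rl idfun (dI x)) = tmap idfun dI (rl x)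
          & tassoc (tmap rr idfun (dI x)) = tmap idfun rl (dI x)]].

Definition dorroh_mul (p q : H * I) : H * I :=
  (mH p.1 q.1, la p.1 q.2 + ra p.2 q.1 + mI p.2 q.2).

Lemma dorroh_mul_is_bilinear : is_bilinear dorroh_mul.
Proof.
split=> [q|p] c u v; rewrite /dorroh_mul /=; congr (_, _).
- exact: linearPl.
- rewrite !linearPl /= !scalerDr (addrACA (c *: _) _ (c *: _)).
  by rewrite (addrACA (c *: _ + c *: _)).
- exact: linearPr.
- rewrite !linearPr /= !scalerDr (addrACA (c *: _) _ (c *: _)).
  by rewrite (addrACA (c *: _ + c *: _)).
Qed.

HB.instance Definition _ := bilinear_isBilinear.Build k (H * I)%type
  (H * I)%type (H * I)%type *:%R *:%R dorroh_mul dorroh_mul_is_bilinear.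

Definition dorroh_inl (h : H) : H * I := (h, 0).
Definition dorroh_inr (x : I) : H * I := (0, x).

Lemma dorroh_inl_linear : linear dorroh_inl.
Proof. by move=> c x y; congr (_, _); rewrite /= scaler0 addr0. Qed.

Lemma dorroh_inr_linear : linear dorroh_inr.
Proof. by move=> c x y; congr (_, _); rewrite /= scaler0 addr0. Qed.

HB.instance Definition _ :=
  GRing.isLinear.Build k H (H * I)%type *:%R dorroh_inl dorroh_inl_linear.
HB.instance Definition _ :=
  GRing.isLinear.Build k I (H * I)%type *:%R dorroh_inr dorroh_inr_linear.

Definition dorroh_comul (p : H * I) : tensor (H * I)%type (H * I)%type :=
  tmap dorroh_inl dorroh_inl (dH p.1) + tmap dorroh_inl dorroh_inr (rl p.2)
  + tmap dorroh_inr dorroh_inl (rr p.2) + tmap dorroh_inr dorroh_inr (dI p.2).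

Lemma dorroh_comul_linear : linear dorroh_comul.
Proof.
move=> c p q; rewrite /dorroh_comul /= !linearP !scalerDr.
by rewrite (addrACA (c *: _)) (addrACA (c *: _ + c *: _)) (addrACA (c *: _ + c *: _ + c *: _)).
Qed.

HB.instance Definition _ := GRing.isLinear.Build k (H * I)%type
  (tensor (H * I)%type (H * I)%type) *:%R dorroh_comul dorroh_comul_linear.

End Dorroh.

Section Subspaces.
Local Open Scope classical_set_scope.

Definition subspace (V : lmodType k) (S : set V) : Prop :=
  S 0 /\ forall c u v, S u -> S v -> S (c *: u + v).

Definition sum_sub (V : lmodType k) (S T : set V) : set V :=
  [set u + v | u in S & v in T].

(* The image of S ⊗ T in V ⊗ W.                                                *)
Definition tensor_sub (V W : lmodType k) (S : set V) (T : set W) :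
    set (tensor V W) :=
  [set t | exists2 s : seq (V * W), (forall p, p \in s -> S p.1 /\ T p.2)
                                  & t = \sum_(p <- s) p.1 ⊗ p.2].

Definition direct_sum (V : lmodType k) (S T : set V) : Prop :=
  sum_sub S T = setT /\ S `&` T = [set 0].

Section Sub.
Variables (B : lmodType k) (m : {bilinear B -> B -> B}).
Variables (d : {linear B -> tensor B B}) (S : set B).

Definition ideal : Prop :=
  subspace S /\ forall b v, S v -> S (m b v) /\ S (m v b).

Definition coideal : Prop :=
  subspace S /\
  forall v, S v -> sum_sub (tensor_sub S setT) (tensor_sub setT S) (d v).

Definition biideal : Prop := ideal /\ coideal.

Definition subbialgebra : Prop :=
  [/\ subspace S, forall u v, S u -> S v -> S (m u v)
    & forall u, S u -> tensor_sub S S (d u)].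

End Sub.

(* H and I are regarded as subspaces of B via the injections iH and iI; H is   *)
(* a subbialgebra when its image is one and iH respects both structures.       *)
Definition bialgebra_dorroh_extension (H I B : lmodType k)
    (mH : {bilinear H -> H -> H}) (dH : {linear H -> tensor H H})
    (mB : {bilinear B -> B -> B}) (dB : {linear B -> tensor B B})
    (iH : {linear H -> B}) (iI : {linear I -> B}) : Prop :=
  [/\ is_bialgebra mH dH /\ is_bialgebra mB dB,
      injective iH /\ injective iI,
      [/\ subbialgebra mB dB (range iH),
          forall a b, iH (mH a b) = mB (iH a) (iH b)
        & forall a, dB (iH a) = tmap iH iH (dH a)],
      biideal mB dB (range iI)
    & direct_sum (range iH) (range iI)].

End Subspaces.
End Structures.

(* Main.v *)
Require Import Defs.
From HB Require Import structures.
From mathcomp Require Import all_boot all_order all_algebra.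
From mathcomp Require Import generic_quotient boolp classical_sets.

Set Implicit Arguments.
Unset Strict Implicit.
Unset Printing Implicit Defensive.

Import GRing.Theory.
Local Open Scope ring_scope.

(* Since H * I is a direct sum, its tensor square is the direct sum of the    *)
(* four blocks H ⊗ H, H ⊗ I, I ⊗ H and I ⊗ I, and the identity                *)
(* Δ((a, x) (b, y)) = Δ(a, x) Δ(b, y) amounts to one identity in each block.   *)
(* Taking x or a, and y or b, to be zero isolates the conditions (a)-(d);     *)
(* conversely, adding these conditions up gives the four block identities.    *)

(** Associativity and coassociativity of [H * I] follow from the two Dorroh pair hypotheses alone
    ([dorroh_mulA], [dorroh_comulA]), so only multiplicativity of the comultiplication is at stake.
    The comultiplication of [(a, x)] has the blocks [dH a], [rl x], [rr x], [dI x]. In each tensor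
    leg the product of two elements of H lies in H and every other product lies in I, so the 16
    products of blocks sort into groups of 1, 3, 3 and 9 ([tens2_blocks]). Since a tensor determines
    its blocks ([blocks_inj]), multiplicativity becomes four equations ([dorroh_comul_mulP]), each
    additive in the contributions of [a b], [a y], [x b] and [x y]. For the extension claim, H is
    closed under product and comultiplication, I absorbs products, and every term of the
    comultiplication of an element of I has a leg in I. *)

Section TensorLemmas.
Variable k : fieldType.

(** Every tensor is a finite sum of pure ones. The empty sum needs no case of its own because it is
    the pure tensor [0 ⊗ 0]. *)
Lemma tens_ind (V W : lmodType k) (P : tensor V W -> Prop) :
    (forall v w, P (v ⊗ w)) -> (forall s t, P s -> P t -> P (s + t)) ->
  forall s, P s.
Proof.
move=> Ptens PD s; rewrite -[s]reprK tens_sum.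
elim: (repr s) => [|p r IHr]; last by rewrite big_cons; apply: PD.
by rewrite big_nil; have := Ptens 0 0; rewrite linear0l.
Qed.

Lemma tmap_tmap (U V W U' V' W' : lmodType k)
    (f : {linear U -> V}) (f' : {linear U' -> V'})
    (g : {linear V -> W}) (g' : {linear V' -> W'}) s :
  tmap g g' (tmap f f' s) = tmap (g \o f) (g' \o f') s.
Proof.
elim/tens_ind: s => [u u'|s t IHs IHt]; first by rewrite !tmap_tens.
by rewrite !linearD /= IHs IHt.
Qed.

Lemma tmap_id (U V : lmodType k) (f : {linear U -> U}) (g : {linear V -> V}) s :
  f =1 id -> g =1 id -> tmap f g s = s.
Proof.
move=> fid gid; elim/tens_ind: s => [u v|s t IHs IHt].
  by rewrite tmap_tens fid gid.
by rewrite linearD /= IHs IHt.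
Qed.

Lemma tmap0l (U V U' V' : lmodType k) (f : {linear U -> V})
    (g : {linear U' -> V'}) s :
  f =1 (fun=> 0) -> tmap f g s = 0.
Proof.
move=> f0; elim/tens_ind: s => [u u'|s t IHs IHt].
  by rewrite tmap_tens f0 linear0l.
by rewrite linearD /= IHs IHt addr0.
Qed.

Lemma tmap0r (U V U' V' : lmodType k) (f : {linear U -> V})
    (g : {linear U' -> V'}) s :
  g =1 (fun=> 0) -> tmap f g s = 0.
Proof.
move=> g0; elim/tens_ind: s => [u u'|s t IHs IHt].
  by rewrite tmap_tens g0 linear0r.
by rewrite linearD /= IHs IHt addr0.
Qed.

Lemma tassoc_tmap (U V W U' V' W' : lmodType k)
    (f : {linear U -> U'}) (g : {linear V -> V'}) (h : {linear W -> W'}) s :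
  tassoc (tmap (tmap f g) h s) = tmap f (tmap g h) (tassoc s).
Proof.
elim/tens_ind: s => [s w|s t IHs IHt]; last by rewrite !linearD /= IHs IHt.
elim/tens_ind: s => [u v|s t IHs IHt].
  by rewrite tmap_tens /= tmap_tens !tassoc_tens !tmap_tens /= tmap_tens.
by rewrite linearDl !linearD /= IHs IHt.
Qed.

(** Naturality of the legwise product. It is used with [inl] and [inr] as the linear maps, to move a
    product of two blocks back into a single block. *)
Lemma tens2_tmap (U V W U' V' W' X Y Z X' Y' Z' : lmodType k)
    (m : {bilinear X -> Y -> Z}) (m' : {bilinear X' -> Y' -> Z'})
    (n : {bilinear U -> V -> W}) (n' : {bilinear U' -> V' -> W'})
    (f : {linear U -> X}) (f' : {linear U' -> X'})
    (g : {linear V -> Y}) (g' : {linear V' -> Y'})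
    (h : {linear W -> Z}) (h' : {linear W' -> Z'}) s t :
    (forall u v, m (f u) (g v) = h (n u v)) ->
    (forall u v, m' (f' u) (g' v) = h' (n' u v)) ->
  tens2 m m' (tmap f f' s) (tmap g g' t) = tmap h h' (tens2 n n' s t).
Proof.
move=> mn mn'; elim/tens_ind: s => [u u'|s s' IHs IHs']; last first.
  by rewrite linearD !linearDl linearD /= IHs IHs'.
elim/tens_ind: t => [v v'|t t' IHt IHt']; last first.
  by rewrite linearD !linearDr linearD /= IHt IHt'.
by rewrite !tmap_tens !tens2_tens tmap_tens mn mn'.
Qed.

End TensorLemmas.

(** * Products and comultiplications in the blocks of the tensor square *)

Section DorrohLemmas.
Variables (k : fieldType) (H I : lmodType k).
Local Notation inl := (@dorroh_inl k H I).
Local Notation inr := (@dorroh_inr k H I).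

Lemma dorroh_split p : p = inl p.1 + inr p.2.
Proof. by case: p => h x; congr (_, _); rewrite /= (addr0, add0r). Qed.

Definition blocks (shh : tensor H H) (shi : tensor H I) (sih : tensor I H)
    (sii : tensor I I) : tensor (H * I)%type (H * I)%type :=
  tmap inl inl shh + tmap inl inr shi + tmap inr inl sih + tmap inr inr sii.

(** The two projections of [H * I] are left inverse to their own injection and kill the other one,
    so each of the four tensor products of projections recovers one block and annihilates the other
    three. *)
Lemma blocks_inj shh shi sih sii thh thi tih tii :
    blocks shh shi sih sii = blocks thh thi tih tii ->
  [/\ shh = thh, shi = thi, sih = tih & sii = tii].
Proof.
pose fstL : {linear (H * I)%type -> H} := fst.
pose sndL : {linear (H * I)%type -> I} := snd.
have fl : fstL \o inl =1 id by [].
have fr : fstL \o inr =1 (fun=> 0) by [].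
have sl : sndL \o inl =1 (fun=> 0) by [].
have sr : sndL \o inr =1 id by [].
have Bhh a b c d : tmap fstL fstL (blocks a b c d) = a.
  rewrite !linearD /= !tmap_tmap.
  by rewrite tmap_id // tmap0r // !tmap0l // !addr0.
have Bhi a b c d : tmap fstL sndL (blocks a b c d) = b.
  rewrite !linearD /= !tmap_tmap.
  by rewrite tmap0r // tmap_id // !tmap0l // !addr0 add0r.
have Bih a b c d : tmap sndL fstL (blocks a b c d) = c.
  rewrite !linearD /= !tmap_tmap.
  (* Fixing [f] keeps the repeated rewriting away from the summands whose first map is
     [sndL \o inr], one of which must survive. *)
  by rewrite !(tmap0l (f := sndL \o inl)) // tmap_id // tmap0r // !add0r addr0.
have Bii a b c d : tmap sndL sndL (blocks a b c d) = d.
  rewrite !linearD /= !tmap_tmap.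
  by rewrite !(tmap0l (f := sndL \o inl)) // tmap0r // tmap_id // !add0r.
move=> E; split.
- by rewrite -(Bhh shh shi sih sii) E Bhh.
- by rewrite -(Bhi shh shi sih sii) E Bhi.
- by rewrite -(Bih shh shi sih sii) E Bih.
- by rewrite -(Bii shh shi sih sii) E Bii.
Qed.

Variables (mH : {bilinear H -> H -> H}) (mI : {bilinear I -> I -> I}).
Variables (la : {bilinear H -> I -> I}) (ra : {bilinear I -> H -> I}).
Variables (dH : {linear H -> tensor H H}) (dI : {linear I -> tensor I I}).
Variables (rl : {linear I -> tensor H I}) (rr : {linear I -> tensor I H}).
Local Notation m := (dorroh_mul mH mI la ra).
Local Notation d := (dorroh_comul dH dI rl rr).

Lemma dorroh_mul_ll a b : m (inl a) (inl b) = inl (mH a b).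
Proof. by rewrite /dorroh_mul /= linear0r !linear0l !addr0. Qed.

Lemma dorroh_mul_lr a y : m (inl a) (inr y) = inr (la a y).
Proof. by rewrite /dorroh_mul /= linear0r linear0r linear0l !addr0. Qed.

Lemma dorroh_mul_rl x b : m (inr x) (inl b) = inr (ra x b).
Proof. by rewrite /dorroh_mul /= !linear0l linear0r add0r addr0. Qed.

Lemma dorroh_mul_rr x y : m (inr x) (inr y) = inr (mI x y).
Proof. by rewrite /dorroh_mul /= !linear0l linear0r !add0r. Qed.

Lemma dorroh_comul_inl a : d (inl a) = tmap inl inl (dH a).
Proof. by rewrite /dorroh_comul /= !linear0 !addr0. Qed.

Lemma dorroh_comul_inr x :
  d (inr x) = tmap inl inr (rl x) + tmap inr inl (rr x) + tmap inr inr (dI x).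
Proof. by rewrite /dorroh_comul /= !linear0 add0r. Qed.

(** Beyond the H-component, a triple product has seven terms, one for each word of length three in H
    and I with a letter I. Three agree by the bimodule laws, three by the mixed laws and one by
    associativity of I. *)
Lemma dorroh_mulA :
  dorroh_pair_algebras mH mI la ra -> is_algebra m.
Proof.
move=> [mHA mIA [laM raM lara _] mixed] [a x] [b y] [c z].
rewrite /= /dorroh_mul /= mHA; congr (_, _).
rewrite !linearDr !linearDl /= laM raM lara mIA.
have [-> _ _] := mixed a y z.
have [_ -> _] := mixed b x z.
have [_ _ ->] := mixed c x y.
by rewrite [LHS](AC (3*1*3) (1*(2*4*6)*(3*5*7))).
Qed.

Lemma tmap_comul_inl (W : lmodType k) (g : {linear W -> (H * I)%type}) s :
  tmap d idfun (tmap inl g s) = tmap (tmap inl inl) g (tmap dH idfun s).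
Proof.
elim/tens_ind: s => [h w|s t IHs IHt]; last by rewrite !linearD /= IHs IHt.
by rewrite !tmap_tens /= dorroh_comul_inl.
Qed.

Lemma tmap_comul_inr (W : lmodType k) (g : {linear W -> (H * I)%type}) s :
  tmap d idfun (tmap inr g s) =
    tmap (tmap inl inr) g (tmap rl idfun s)
    + tmap (tmap inr inl) g (tmap rr idfun s)
    + tmap (tmap inr inr) g (tmap dI idfun s).
Proof.
elim/tens_ind: s => [x w|s t IHs IHt].
  by rewrite !tmap_tens /= dorroh_comul_inr !linearDl.
rewrite !linearD /= IHs IHt.
by rewrite [LHS](AC (3*3) ((1*4)*(2*5)*(3*6))).
Qed.

Lemma tmap_inl_comul (W : lmodType k) (g : {linear W -> (H * I)%type}) s :
  tmap idfun d (tmap g inl s) = tmap g (tmap inl inl) (tmap idfun dH s).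
Proof.
elim/tens_ind: s => [w h|s t IHs IHt]; last by rewrite !linearD /= IHs IHt.
by rewrite !tmap_tens /= dorroh_comul_inl.
Qed.

Lemma tmap_inr_comul (W : lmodType k) (g : {linear W -> (H * I)%type}) s :
  tmap idfun d (tmap g inr s) =
    tmap g (tmap inl inr) (tmap idfun rl s)
    + tmap g (tmap inr inl) (tmap idfun rr s)
    + tmap g (tmap inr inr) (tmap idfun dI s).
Proof.
elim/tens_ind: s => [w x|s t IHs IHt].
  by rewrite !tmap_tens /= dorroh_comul_inr !linearDr.
rewrite !linearD /= IHs IHt.
by rewrite [LHS](AC (3*3) ((1*4)*(2*5)*(3*6))).
Qed.

(** Dual to [dorroh_mulA]: on H this is coassociativity of [dH], and on I the seven blocks other
    than H ⊗ H ⊗ H match by the three bicomodule laws, the three mixed laws and coassociativity of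
    [dI]. *)
Lemma dorroh_comulA :
  dorroh_pair_coalgebras dH dI rl rr -> is_coalgebra d.
Proof.
move=> [dHA dIA [rlA rrA rlr _] mixed] p.
have El a : tassoc (tmap d idfun (d (inl a))) = tmap idfun d (d (inl a)).
  by rewrite dorroh_comul_inl tmap_comul_inl tmap_inl_comul tassoc_tmap dHA.
have Er x : tassoc (tmap d idfun (d (inr x))) = tmap idfun d (d (inr x)).
  have [m1 m2 m3] := mixed x.
  rewrite dorroh_comul_inr !linearD /= tmap_comul_inl !tmap_comul_inr.
  rewrite tmap_inl_comul !tmap_inr_comul !linearD /= !tassoc_tmap.
  rewrite rlA rrA rlr dIA -m1 m2 m3.
  by rewrite [LHS](AC (1*3*3) ((1*2*5)*3*(6*4*7))).
rewrite (dorroh_split p) (linearD d) /=.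
(* Making both comultiplications opaque lets additivity act on the outer maps only. *)
move: (d _) (d _) (El p.1) (Er p.2) => s t Es Et.
by rewrite !linearD /= Es Et.
Qed.

Lemma tens2_blocks shh shi sih sii thh thi tih tii :
  tens2 m m (blocks shh shi sih sii) (blocks thh thi tih tii) =
  blocks (tens2 mH mH shh thh)
    (tens2 mH la shh thi + tens2 mH ra shi thh + tens2 mH mI shi thi)
    (tens2 la mH shh tih + tens2 ra mH sih thh + tens2 mI mH sih tih)
    (tens2 la la shh tii + tens2 ra ra sii thh
     + (tens2 la ra shi tih + tens2 la mI shi tii + tens2 ra la sih thi
        + tens2 mI la sih tii + tens2 ra mI sii thi + tens2 mI ra sii tih
        + tens2 mI mI sii tii)).
Proof.
have [ll lr] := (dorroh_mul_ll, dorroh_mul_lr).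
have [rL rR] := (dorroh_mul_rl, dorroh_mul_rr).
rewrite /blocks !linearDl !linearDr ![in RHS]linearD /=.
rewrite (tens2_tmap _ _ ll ll) (tens2_tmap _ _ ll lr) (tens2_tmap _ _ ll rL).
rewrite (tens2_tmap _ _ ll rR) (tens2_tmap _ _ lr ll) (tens2_tmap _ _ lr lr).
rewrite (tens2_tmap _ _ lr rL) (tens2_tmap _ _ lr rR) (tens2_tmap _ _ rL ll).
rewrite (tens2_tmap _ _ rL lr) (tens2_tmap _ _ rL rL) (tens2_tmap _ _ rL rR).
rewrite (tens2_tmap _ _ rR ll) (tens2_tmap _ _ rR lr) (tens2_tmap _ _ rR rL).
rewrite (tens2_tmap _ _ rR rR).
(* With the blocks ordered HH, HI, IH, II, the product of left block i and right block j is term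
   4(i-1)+j. The last seven indices form the right-hand side of (d). *)
by rewrite [LHS](AC (4*4*4*4)
  (1*(2*5*6)*(3*9*11)*(4*13*(7*8*10*12*14*15*16)))).
Qed.

Lemma dorroh_comul_mulP a x b y :
  d (m (a, x) (b, y)) = tens2 m m (d (a, x)) (d (b, y)) <->
  [/\ dH (mH a b) = tens2 mH mH (dH a) (dH b),
      rl (la a y + ra x b + mI x y) =
        tens2 mH la (dH a) (rl y) + tens2 mH ra (rl x) (dH b)
        + tens2 mH mI (rl x) (rl y),
      rr (la a y + ra x b + mI x y) =
        tens2 la mH (dH a) (rr y) + tens2 ra mH (rr x) (dH b)
        + tens2 mI mH (rr x) (rr y)
    & dI (la a y + ra x b + mI x y) =
        tens2 la la (dH a) (dI y) + tens2 ra ra (dI x) (dH b)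
        + (tens2 la ra (rl x) (rr y) + tens2 la mI (rl x) (dI y)
           + tens2 ra la (rr x) (rl y) + tens2 mI la (rr x) (dI y)
           + tens2 ra mI (dI x) (rl y) + tens2 mI ra (dI x) (rr y)
           + tens2 mI mI (dI x) (dI y))].
Proof.
split=> [E|[Ehh Ehi Eih Eii]]; last first.
  (* The left-hand side is this [blocks] expression by mere unfolding. *)
  transitivity (blocks (dH (mH a b)) (rl (la a y + ra x b + mI x y))
    (rr (la a y + ra x b + mI x y)) (dI (la a y + ra x b + mI x y))) => //.
  by rewrite Ehh Ehi Eih Eii -tens2_blocks.
by apply: blocks_inj; rewrite -tens2_blocks.
Qed.

End DorrohLemmas.

(** * Subspaces and tensors supported on them *)

Section Subspaces.
Local Open Scope classical_set_scope.
Variable k : fieldType.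

Lemma subspace_range (V W : lmodType k) (f : {linear V -> W}) :
  subspace (range f).
Proof.
split=> [|c _ _ [u _ <-] [v _ <-]]; first by exists 0; rewrite ?linear0.
by exists (c *: u + v); rewrite ?linearP.
Qed.

Lemma tensor_subD (V W : lmodType k) (S : set V) (T : set W) s t :
  tensor_sub S T s -> tensor_sub S T t -> tensor_sub S T (s + t).
Proof.
move=> [p pST ->] [q qST ->]; exists (p ++ q); last by rewrite big_cat.
by move=> u; rewrite mem_cat => /orP[/pST|/qST].
Qed.

Lemma tensor_sub_tmap (U U' V W : lmodType k) (S : set V) (T : set W)
    (f : {linear U -> V}) (g : {linear U' -> W}) s :
  (forall u, S (f u)) -> (forall u, T (g u)) -> tensor_sub S T (tmap f g s).
Proof.
move=> Sf Tg; elim/tens_ind: s => [u v|s t IHs IHt].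
  exists [:: (f u, g v)]; last by rewrite big_seq1 tmap_tens.
  by move=> p; rewrite inE => /eqP ->; split; [exact: Sf | exact: Tg].
by rewrite linearD; exact: tensor_subD.
Qed.

End Subspaces.

Theorem proposition1p2 (k : fieldType) (H I : lmodType k)
    (mH : {bilinear H -> H -> H}) (mI : {bilinear I -> I -> I})
    (la : {bilinear H -> I -> I}) (ra : {bilinear I -> H -> I})
    (dH : {linear H -> tensor H H}) (dI : {linear I -> tensor I I})
    (rl : {linear I -> tensor H I}) (rr : {linear I -> tensor I H})
    (hA : dorroh_pair_algebras mH mI la ra)
    (hC : dorroh_pair_coalgebras dH dI rl rr) :
  (is_bialgebra (dorroh_mul mH mI la ra) (dorroh_comul dH dI rl rr) <->
   [/\ is_bialgebra mH dH,
       forall (a b : H) (x y : I),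
         [/\ dI (la a y) = tens2 la la (dH a) (dI y)
               /\ dI (ra x b) = tens2 ra ra (dI x) (dH b),
             rl (la a y) = tens2 mH la (dH a) (rl y)
               /\ rl (ra x b) = tens2 mH ra (rl x) (dH b)
           & rr (la a y) = tens2 la mH (dH a) (rr y)
               /\ rr (ra x b) = tens2 ra mH (rr x) (dH b)],
       forall x y : I,
         rl (mI x y) = tens2 mH mI (rl x) (rl y)
           /\ rr (mI x y) = tens2 mI mH (rr x) (rr y)
     & forall x y : I,
         dI (mI x y) =
           tens2 la ra (rl x) (rr y) + tens2 la mI (rl x) (dI y)
           + tens2 ra la (rr x) (rl y) + tens2 mI la (rr x) (dI y)
           + tens2 ra mI (dI x) (rl y) + tens2 mI ra (dI x) (rr y)
           + tens2 mI mI (dI x) (dI y)])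
  /\
  (is_bialgebra (dorroh_mul mH mI la ra) (dorroh_comul dH dI rl rr) ->
   bialgebra_dorroh_extension mH dH
     (dorroh_mul mH mI la ra) (dorroh_comul dH dI rl rr)
     (@dorroh_inl k H I) (@dorroh_inr k H I)).
Proof.
have [[mHA _ _ _] [dHA _ _ _]] := (hA, hC).
set m := dorroh_mul mH mI la ra; set d := dorroh_comul dH dI rl rr.
have bialgH : is_bialgebra m d -> is_bialgebra mH dH.
  move=> [_ _ dm]; split=> // a b.
  by have [] := (dorroh_comul_mulP _ _ _ _ _ _ _ _ a 0 b 0).1 (dm _ _).
split.
  split=> [hB|[[_ _ dmH] hb hc hd]].
    have [_ _ dm] := hB.
    have E a x b y := (dorroh_comul_mulP _ _ _ _ _ _ _ _ a x b y).1 (dm _ _).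
    split; first exact: bialgH.
    (* The products [(a, 0) (0, y)] and [(0, x) (b, 0)] have one zero I-component, which kills every
       term involving both; what remains is the left and the right half of (b). *)
    - move=> a b x y; have := E a 0 0 y; have := E 0 x b 0.
      rewrite !linear0 !linear0l !linear0r !addr0 !add0r.
      by move=> [_ -> -> ->] [_ -> -> ->].
    (* With both H-components zero only the contribution of [x y] survives: the mixed blocks give
       (c), and the I ⊗ I block gives (d). *)
    - move=> x y; have := E 0 x 0 y.
      rewrite !linear0 !linear0l !linear0r !addr0 !add0r.
      by move=> [_ -> ->].
    - move=> x y; have := E 0 x 0 y.
      rewrite !linear0 !linear0l !linear0r !addr0 !add0r.
      by move=> [_ _ _ ->].
  split; [exact: dorroh_mulA | exact: dorroh_comulA |].
  move=> [a x] [b y]; apply/dorroh_comul_mulP; rewrite !linearD /= hd dmH.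
  have [[-> ->] [-> ->] [-> ->]] := hb a b x y.
  by have [-> ->] := hc x y.
move=> hB; split; first by split=> //; exact: bialgH.
- by split=> [a b []|x y []].
- split=> [|a b|a]; [|exact/esym/dorroh_mul_ll|exact: dorroh_comul_inl].
  split=> [|_ _ [a _ <-] [b _ <-]|_ [a _ <-]]; first exact: subspace_range.
    by exists (mH a b) => //; exact/esym/dorroh_mul_ll.
  by rewrite [X in tensor_sub _ _ X]dorroh_comul_inl; apply: tensor_sub_tmap => u; exists u.
- split; split; try exact: subspace_range.
    move=> [b y] _ [x _ <-]; split.
      exists (la b x + mI y x) => //.
      by rewrite /= /dorroh_mul /= linear0r linear0r addr0.
    exists (ra x b + mI x y) => //.
    by rewrite /= /dorroh_mul /= !linear0l add0r.
  move=> _ [x _ <-]; rewrite [X in sum_sub _ _ X]dorroh_comul_inr -addrA addrC.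
  (* The I ⊗ I term fits either summand of the coideal condition; it is put with [rr x] in I ⊗ B,
     leaving [rl x] in B ⊗ I. *)
  exists (tmap (@dorroh_inr k H I) (@dorroh_inl k H I) (rr x)
          + tmap (@dorroh_inr k H I) (@dorroh_inr k H I) (dI x)).
    by apply: tensor_subD; apply: tensor_sub_tmap => // u; exists u.
  exists (tmap (@dorroh_inl k H I) (@dorroh_inr k H I) (rl x)) => //.
  by apply: tensor_sub_tmap => // u; exists u.
- split; apply/seteqP; split=> // p.
  + move=> _; exists (dorroh_inl I p.1); first by exists p.1.
    by exists (dorroh_inr H p.2); [exists p.2 | rewrite -dorroh_split].
  + by move=> [[a _ <-] [x _ [<- _]]].
  + by move=> ->; split; exists 0.
Qed.
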